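(* Let $W$ be a $\phi$-coordinated $V_{\widehat{\mathfrak{L}^*}}(\ell_{1234},0)$-module. Then $W$ is a restricted $\mathcal{L}^*$-module of level $\ell_{1234}$, on which $T_m(x)$ acts as $Y_W((T^m)_{-1}\mathbf{1},x)$ and $E_m(x)$ acts as $Y_W((E^m)_{-1}\mathbf{1},x)$ for all $m\in\mathbb{Z}$.
   Context: The rank two twisted Heisenberg–Virasoro algebra $\mathcal{L}^*$ has basis $\{t_1^mt_2^n, E_{m,n}: (m,n)\in\mathbb{Z}^2\setminus\{(0,0)\}\}\cup\{K_1,K_2,K_3,K_4\}$, $K_i$ central, with $[t_1^mt_2^n,t_1^rt_2^s]=0$, $[t_1^mt_2^n,E_{r,s}]=(nr-ms)t_1^{m+r}t_2^{n+s}+\delta_{m+r,0}\delta_{n+s,0}(mK_1+nK_2)$, $[E_{m,n},E_{r,s}]=(nr-ms)E_{m+r,n+s}+\delta_{m+r,0}\delta_{n+s,0}(mK_3+nK_4)$ (terms with index $(0,0)$ are interpreted as $0$). Set $T_m(x)=\sum_{n\in\mathbb{Z}}t_1^mt_2^nx^{-n}$ and $E_m(x)=\sum_nE_{m,n}x^{-n}$ (omitting $(0,0)$ terms). An $\mathcal{L}^*$-module $W$ is restricted if $T_m(x),E_m(x)\in\mathrm{Hom}(W,W((x)))$ for all $m$, i.e. for each $w$, $t_1^mt_2^nw=0$ and $E_{m,n}w=0$ for $n$ sufficiently large; it has level $\ell_{1234}$ if $K_i$ acts as $\ell_i\in\mathbb{C}$. $\widehat{\mathfrak{L}^*}$ is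 the Lie algebra with basis $\{T^m\otimes t^n, E^r\otimes t^s:(m,n),(r,s)\in\mathbb{Z}^2\}\cup\{K_1,\dots,K_4\}$, $K_i$ central, $[T^m\otimes t^n,T^r\otimes t^s]=0$, $[T^m\otimes t^n,E^r\otimes t^s]=(nr-ms)T^{m+r}\otimes t^{n+s-1}+m\delta_{m+r,0}\delta_{n+s+1,0}K_1+n\delta_{m+r,0}\delta_{n+s,0}K_2$, $[E^m\otimes t^n,E^r\otimes t^s]=(nr-ms)E^{m+r}\otimes t^{n+s-1}+m\delta_{m+r,0}\delta_{n+s+1,0}K_3+n\delta_{m+r,0}\delta_{n+s,0}K_4$. Write $(T^m)_n=T^m\otimes t^n$, $(E^r)_s=E^r\otimes t^s$. $V_{\widehat{\mathfrak{L}^*}}(\ell_{1234},0)=U(\widehat{\mathfrak{L}^*})\otimes_{U(\widehat{\mathfrak{L}^*}_{\ge0})}\mathbb{C}$, where $\widehat{\mathfrak{L}^*}_{\ge0}$ is spanned by $T^m\otimes t^n,E^r\otimes t^n$ ($n\ge0$) acting as $0$ and $K_i$ acting as $\ell_i$; $\mathbf{1}=1\otimes1$. It is a vertex algebra with vacuum $\mathbf{1}$, $Y((T^m)_{-1}\mathbf{1},x)=\sum_n(T^m)_nx^{-n-1}$, $Y((E^r)_{-1}\mathbf{1},x)=\sum_s(E^r)_sx^{-s-1}$, generated by $\{(T^m)_{-1}\mathbf{1},(E^r)_{-1}\mathbf{1}\}$. A $\phi$-coordinated module ($\phi(x,z)=xe^z$) for a vertex algebra $V$ is a space $W$ with a linear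 map $Y_W(\cdot,x):V\to\mathrm{Hom}(W,W((x)))$ such that $Y_W(\mathbf{1},x)=\mathbf{1}_W$ and for $u,v\in V$ there is $k\in\mathbb{N}$ with $(x_1-x_2)^kY_W(u,x_1)Y_W(v,x_2)\in\mathrm{Hom}(W,W((x_1,x_2)))$ and $(x_2e^z-x_2)^kY_W(Y(u,z)v,x_2)=((x_1-x_2)^kY_W(u,x_1)Y_W(v,x_2))|_{x_1=x_2e^z}$.
   Formalization: For m=0 the identification of T_0(x), E_0(x) with Y_W((T^0)_{-1}1,x), Y_W((E^0)_{-1}1,x) is claimed only for the coefficients of x^{-n}, n≠0: the constant terms need not vanish (W=C, level 0, Y_W((T^0)_{-1}1,x)=c), though T_0 and E_0 omit the (0,0) term. *)

(* Defs.v *)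
From HB Require Import structures.
From mathcomp Require Import all_boot all_order all_algebra.
Set Implicit Arguments. Unset Strict Implicit. Unset Printing Implicit Defensive.
Import Order.TTheory GRing.Theory Num.Theory.
Local Open Scope ring_scope.

Section Defs.
Variable C : numClosedFieldType.

Definition K1 : 'I_4 := @Ordinal 4 0 isT.
Definition K2 : 'I_4 := @Ordinal 4 1 isT.
Definition K3 : 'I_4 := @Ordinal 4 2 isT.
Definition K4 : 'I_4 := @Ordinal 4 3 isT.

Definition lin (M N : lmodType C) (f : M -> N) : Prop :=
  forall (a : C) (x y : M), f (a *: x + y) = a *: f x + f y.

Definition dlt (b : bool) : C := (b : nat)%:R.

Definition nat_of_int (z : int) : nat :=
  match z with Posz n => n | Negz _ => 0%N end.

(* Modules for the Lie algebra \hat{L^*}, given by the operators       *)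
(* tT m n = (T^m)_n, tE m n = (E^m)_n, tK i = K_i satisfying the       *)
(* defining bracket relations of \hat{L^*} (with commutators).         *)
Definition Lhat_module (M : lmodType C) (tT tE : int -> int -> M -> M)
    (tK : 'I_4 -> M -> M) : Prop :=
  [/\ (forall m n, lin (tT m n) /\ lin (tE m n)) /\ (forall i, lin (tK i)),
      (forall i m n x, tK i (tT m n x) = tT m n (tK i x)
                    /\ tK i (tE m n x) = tE m n (tK i x)),
      (forall i j x, tK i (tK j x) = tK j (tK i x))
      /\ (forall m n r s x, tT m n (tT r s x) - tT r s (tT m n x) = 0),
      (forall m n r s x,
          tT m n (tE r s x) - tE r s (tT m n x) =
            (n * r - m * s)%:~R *: tT (m + r) (n + s - 1) x
          + (m%:~R * dlt ((m + r == 0) && (n + s + 1 == 0))) *: tK K1 x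
          + (n%:~R * dlt ((m + r == 0) && (n + s == 0))) *: tK K2 x) &
      (forall m n r s x,
          tE m n (tE r s x) - tE r s (tE m n x) =
            (n * r - m * s)%:~R *: tE (m + r) (n + s - 1) x
          + (m%:~R * dlt ((m + r == 0) && (n + s + 1 == 0))) *: tK K3 x
          + (n%:~R * dlt ((m + r == 0) && (n + s == 0))) *: tK K4 x)].

Definition vacuum_vector (l : 'I_4 -> C) (M : lmodType C)
    (tT tE : int -> int -> M -> M) (tK : 'I_4 -> M -> M) (m0 : M) : Prop :=
  (forall m n, 0 <= n -> tT m n m0 = 0 /\ tE m n m0 = 0)
  /\ (forall i, tK i m0 = l i *: m0).

Definition Lhat_hom (M N : lmodType C)
    (tT tE : int -> int -> M -> M) (tK : 'I_4 -> M -> M)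
    (sT sE : int -> int -> N -> N) (sK : 'I_4 -> N -> N) (f : M -> N) : Prop :=
  [/\ lin f,
      (forall m n x, f (tT m n x) = sT m n (f x) /\ f (tE m n x) = sE m n (f x)) &
      (forall i x, f (tK i x) = sK i (f x))].

(* (V, tT, tE, tK, one) is the induced module
   V_{\hat{L^*}}(l,0) = U(\hat{L^*}) \otimes_{U(\hat{L^*}_{>=0})} C_l,
   characterised by its universal property. *)
Definition induced_vacuum_module (l : 'I_4 -> C) (V : lmodType C)
    (tT tE : int -> int -> V -> V) (tK : 'I_4 -> V -> V) (one : V) : Prop :=
  [/\ Lhat_module tT tE tK,
      vacuum_vector l tT tE tK one &
      forall (M : lmodType C) (sT sE : int -> int -> M -> M)
             (sK : 'I_4 -> M -> M) (m0 : M),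
        Lhat_module sT sE sK -> vacuum_vector l sT sE sK m0 ->
        (exists f : V -> M, Lhat_hom tT tE tK sT sE sK f /\ f one = m0)
        /\ (forall f g : V -> M,
              Lhat_hom tT tE tK sT sE sK f -> f one = m0 ->
              Lhat_hom tT tE tK sT sE sK g -> g one = m0 ->
              forall x, f x = g x)].

(* Vertex algebras: Y u v n = u_n v, i.e. Y(u,z)v = sum_n u_n v z^{-n-1} *)

Definition binz (r : int) (i : nat) : C :=
  (\prod_(j < i) (r - j%:Z)%:~R) / (i`!)%:R.

Definition vertex_algebra (V : lmodType C) (Y : V -> V -> int -> V) (one : V)
  : Prop :=
  [/\ (forall v n, lin (fun u => Y u v n)) /\ (forall u n, lin (fun v => Y u v n)),
      (forall u v, exists N : int, forall n, N <= n -> Y u v n = 0),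
      (forall v n, Y one v n = if n == -1 then v else 0)
      /\
      (forall u, Y u one (-1) = u /\ forall n, 0 <= n -> Y u one n = 0) &
      (* Jacobi identity, in the component (Borcherds) form; the sums are
         finite, and are taken over any range beyond which all terms vanish *)
      (forall u v w (p q r : int) (M : nat),
        (forall i : nat, (M <= i)%N ->
            [/\ Y u v (r + i%:Z) = 0, Y v w (q + i%:Z) = 0 & Y u w (p + i%:Z) = 0]) ->
        \sum_(i < M) binz p i *: Y (Y u v (r + (i : nat)%:Z)) w (p + q - (i : nat)%:Z)
        = \sum_(i < M) ((-1) ^+ i * binz r i) *:
             (Y u (Y v w (q + (i : nat)%:Z)) (p + r - (i : nat)%:Z)
              - (-1) ^+ (absz r) *: Y v (Y u w (p + (i : nat)%:Z)) (q + r - (i : nat)%:Z)))].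

(* phi-coordinated modules, phi(x,z) = x e^z.
   YW v j w = coefficient of x^j in Y_W(v,x)w. *)

(* coefficient of x1^a x2^b in (x1 - x2)^k Y_W(u,x1) Y_W(v,x2) w *)
Definition prod_coef (V W : lmodType C) (YW : V -> int -> W -> W)
    (u v : V) (k : nat) (w : W) (a b : int) : W :=
  \sum_(i < k.+1) ('C(k, i)%:R * (-1) ^+ i) *:
      YW u (a - (k - i)%N%:Z) (YW v (b - (i : nat)%:Z) w).

(* coefficient of z^i in (e^z - 1)^k *)
Definition expm1_coef (k i : nat) : C :=
  (\sum_(j < k.+1) 'C(k, j)%:R * (-1) ^+ (k - j) * (j%:R) ^+ i) / (i`!)%:R.

(* coefficient of x2^p z^q in (x2 e^z - x2)^k Y_W(Y(u,z)v, x2) w, where the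
   sum over n (u_n v) is taken over any range beyond which u_n v = 0 *)
Definition lhs_coef (V W : lmodType C) (Y : V -> V -> int -> V)
    (YW : V -> int -> W -> W) (u v : V) (k : nat) (w : W) (M : nat)
    (p q : int) : W :=
  \sum_(i < M) expm1_coef k i *: YW (Y u v ((i : nat)%:Z - q - 1)) (p - k%:Z) w.

(* coefficient of x2^p z^q in
   ((x1-x2)^k Y_W(u,x1)Y_W(v,x2)w)|_{x1 = x2 e^z}, given that the
   coefficients of x1^a x2^b vanish for a < N or b < N *)
Definition subst_coef (V W : lmodType C) (YW : V -> int -> W -> W)
    (u v : V) (k : nat) (w : W) (N p : int) (q : nat) : W :=
  \sum_(i < nat_of_int (p - N - N + 1))
     (((N + (i : nat)%:Z)%:~R) ^+ q / (q`!)%:R) *: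
        prod_coef YW u v k w (N + (i : nat)%:Z) (p - (N + (i : nat)%:Z)).

Definition phi_coordinated_module (V : lmodType C) (Y : V -> V -> int -> V)
    (one : V) (W : lmodType C) (YW : V -> int -> W -> W) : Prop :=
  [/\ (forall j w, lin (fun v => YW v j w)),
      (forall v j, lin (YW v j)),
      (forall v w, exists N : int, forall j, j < N -> YW v j w = 0),
      (forall j w, YW one j w = if j == 0 then w else 0) &
      forall u v, exists k : nat,
        (* (x1-x2)^k Y_W(u,x1)Y_W(v,x2) \in Hom(W, W((x1,x2))) *)
        (forall w, exists N : int, forall a b, (a < N) || (b < N) ->
                     prod_coef YW u v k w a b = 0)
        /\
        (forall w (N : int), (forall a b, (a < N) || (b < N) ->
                                prod_coef YW u v k w a b = 0) ->
         forall (p q : int) (M : nat),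
           (forall i : nat, (M <= i)%N -> Y u v (i%:Z - q - 1) = 0) ->
           lhs_coef Y YW u v k w M p q =
             if q < 0 then 0 else subst_coef YW u v k w N p (absz q))].

(* Modules for L^*: t m n = action of t_1^m t_2^n, e m n = action of E_{m,n}
   (only (m,n) <> (0,0) is meaningful), k i = action of K_i.
   Terms with index (0,0) are interpreted as 0. *)
Definition nz (m n : int) : bool := ~~ ((m == 0) && (n == 0)).

Definition Lstar_module (W : lmodType C) (t e : int -> int -> W -> W)
    (k : 'I_4 -> W -> W) : Prop :=
  [/\ (forall m n, nz m n -> lin (t m n) /\ lin (e m n)) /\ (forall i, lin (k i)),
      (forall i m n x, nz m n ->
          k i (t m n x) = t m n (k i x) /\ k i (e m n x) = e m n (k i x)),
      (forall i j x, k i (k j x) = k j (k i x))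
      /\ (forall m n r s x, nz m n -> nz r s ->
          t m n (t r s x) - t r s (t m n x) = 0),
      (forall m n r s x, nz m n -> nz r s ->
          t m n (e r s x) - e r s (t m n x) =
            (if nz (m + r) (n + s)
             then (n * r - m * s)%:~R *: t (m + r) (n + s) x else 0)
          + dlt ((m + r == 0) && (n + s == 0)) *:
              (m%:~R *: k K1 x + n%:~R *: k K2 x)) &
      (forall m n r s x, nz m n -> nz r s ->
          e m n (e r s x) - e r s (e m n x) =
            (if nz (m + r) (n + s)
             then (n * r - m * s)%:~R *: e (m + r) (n + s) x else 0)
          + dlt ((m + r == 0) && (n + s == 0)) *:
              (m%:~R *: k K3 x + n%:~R *: k K4 x))].

(* restricted: T_m(x), E_m(x) \in Hom(W, W((x))) *)
Definition restricted (W : lmodType C) (t e : int -> int -> W -> W) : Prop :=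
  forall m (w : W), exists N : int, forall n, N <= n -> nz m n ->
    t m n w = 0 /\ e m n w = 0.

Definition restricted_Lstar_module_of_level (l : 'I_4 -> C) (W : lmodType C)
    (t e : int -> int -> W -> W) : Prop :=
  Lstar_module t e (fun i w => l i *: w) /\ restricted t e.

End Defs.

(* Main.v *)
(* For fixed w and total degree p, write f(a) and g(a) for the coefficients of
   x1^a x2^(p-a) in Y_W(u,x1)Y_W(v,x2)w and Y_W(v,x2)Y_W(u,x1)w. Applying the
   module axiom to the pairs (u,v) and (v,u), and cancelling factors e^z - 1,
   one may take k equal to the order d of the pole of Y(u,z)v in both. The
   substitution x1 = x2 e^z turns (x1-x2)^d f and (x1-x2)^d g into the same
   series: this is skew symmetry in V combined with
   Y_W(e^{zD} v, x) = Y_W(v, x e^z), itself the module axiom for the pair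
   (v, 1). Exponentials being linearly independent, (x1-x2)^d f = (x1-x2)^d g.
   As f and g expand the same rational function in opposite directions, f - g
   is a residue, which for d = 2 reads
   [u_a, v_b] = (u_0 v)_{a+b} - a (u_1 v)_{a+b}; the brackets of L^* follow
   from those of the generators of V. *)
Require Import Defs.
From HB Require Import structures.
From mathcomp Require Import all_boot all_order all_algebra.
From mathcomp Require Import zify ring.
From Stdlib Require Import FunctionalExtensionality.
Import Order.TTheory GRing.Theory Num.Theory.
Local Open Scope ring_scope.
Set Implicit Arguments.
Unset Strict Implicit.
Unset Printing Implicit Defensive.

(** * Formal power series in [z], as sequences of coefficients *)

Section PowerSeries.
Variables (C : numClosedFieldType) (W : lmodType C).
Implicit Types (s t : nat -> W) (x y : C).

(** The coefficient of [z^i] in [e^{xz}]. *)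
Definition exp_coef x (i : nat) : C := x ^+ i / i`!%:R.

Lemma factR_neq0 (n : nat) : n`!%:R != 0 :> C.
Proof. by rewrite pnatr_eq0 -lt0n fact_gt0. Qed.

Lemma exp_coef0 x : exp_coef x 0 = 1.
Proof. by rewrite /exp_coef expr0 fact0 divr1. Qed.

Lemma exp_coefD x y n :
  exp_coef (x + y) n = \sum_(i < n.+1) exp_coef x i * exp_coef y (n - i).
Proof.
rewrite /exp_coef [x + y]addrC exprDn mulr_suml; apply: eq_bigr => i _.
have le_in : (i <= n)%N by rewrite -ltnS.
have := bin_fact le_in; move/(congr1 (fun k : nat => k%:R : C)).
rewrite !natrM => <-; rewrite -mulr_natr.
have := factR_neq0 i; have := factR_neq0 (n - i).
have: 'C(n, i)%:R != 0 :> C by rewrite pnatr_eq0 -lt0n bin_gt0.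
by move=> *; field; apply/and3P.
Qed.

(** Multiplication by [e^{xz}]. *)
Definition exp_mul x s (n : nat) : W :=
  \sum_(i < n.+1) exp_coef x i *: s (n - i)%N.

Lemma exp_mulD x y s : exp_mul x (exp_mul y s) = exp_mul (x + y) s.
Proof.
apply: functional_extensionality => n; rewrite /exp_mul.
under [RHS]eq_bigr => k _ do rewrite exp_coefD scaler_suml.
rewrite -(big_mkord xpredT (fun k => \sum_(i < k.+1)
  (exp_coef x i * exp_coef y (k - i)) *: s (n - k)%N)).
under [RHS]eq_bigr => k _ do rewrite -(big_mkord xpredT (fun i =>
  (exp_coef x i * exp_coef y (k - i)) *: s (n - k)%N)).
under [RHS]eq_big_nat => k /andP [_ kn] do rewrite (big_nat_widen _ _ n.+1) //=.
rewrite (exchange_big_dep_nat xpredT) //= big_mkord; apply: eq_bigr => i _.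
have le_in : (i <= n)%N by rewrite -ltnS.
rewrite scaler_sumr -(big_mkord xpredT (fun j => exp_coef x i *:
  (exp_coef y j *: s (n - i - j)%N))) /=.
under [RHS]eq_bigl => k do rewrite ltnS.
rewrite -[RHS](big_nat_widenl i 0 n.+1 xpredT) // [RHS](big_addn 0 n.+1 i xpredT) subSn //.
rewrite !big_nat; apply: eq_bigr => j /andP[_ lt_jn].
by rewrite addnK addnC subnDA scalerA.
Qed.

Lemma exp_mul0 s : exp_mul 0 s = s.
Proof.
apply: functional_extensionality => n; rewrite /exp_mul big_ord_recl /= subn0.
rewrite exp_coef0 scale1r big1 ?addr0 // => i _.
by rewrite /exp_coef expr0n /= mul0r scale0r.
Qed.

Lemma exp_mulB x s t :
  exp_mul x (fun n => s n - t n) = fun n => exp_mul x s n - exp_mul x t n.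
Proof.
apply: functional_extensionality => n; rewrite /exp_mul -sumrB.
by apply: eq_bigr => i _; rewrite scalerBr.
Qed.

Lemma exp_mulZ x (a : C) s :
  exp_mul x (fun n => a *: s n) = fun n => a *: exp_mul x s n.
Proof.
apply: functional_extensionality => n; rewrite /exp_mul scaler_sumr.
by apply: eq_bigr => i _; rewrite !scalerA mulrC.
Qed.

(** Multiplication by [z]; its powers clear the pole of [Y(u,z)v]. *)
Definition shiftz s (n : nat) : W := if n is m.+1 then s m else 0.

Lemma iter_shiftzD d s n : iter d shiftz s (n + d)%N = s n.
Proof. by elim: d => [|d IH] /=; rewrite ?addn0 ?addnS. Qed.

Lemma iter_shiftz_lt d s n : (n < d)%N -> iter d shiftz s n = 0.
Proof. by elim: d n => [|d IH] [|n] //=; apply: IH. Qed.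

Lemma exp_mul_shiftz x s : exp_mul x (shiftz s) = shiftz (exp_mul x s).
Proof.
apply: functional_extensionality => -[|n]; rewrite /exp_mul /=.
  by rewrite big_ord1 scaler0.
rewrite big_ord_recr /= subnn scaler0 addr0.
by apply: eq_bigr => i _; rewrite subSn // -ltnS.
Qed.

(* Multiplication by [e^z - 1]. *)
Definition expm1_mul s (n : nat) : W := exp_mul 1 s n - s n.

Lemma expm1_mul_shiftz s : expm1_mul (shiftz s) = shiftz (expm1_mul s).
Proof.
rewrite /expm1_mul exp_mul_shiftz.
by apply: functional_extensionality => -[|n] /=; rewrite ?subr0.
Qed.

Lemma expm1_mul_iter_shiftz d s :
  expm1_mul (iter d shiftz s) = iter d shiftz (expm1_mul s).
Proof. by elim: d => //= d IH; rewrite expm1_mul_shiftz IH. Qed.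

Lemma exp_mul_expm1_mul x s : exp_mul x (expm1_mul s) = expm1_mul (exp_mul x s).
Proof. by rewrite /expm1_mul exp_mulB !exp_mulD addrC. Qed.

Lemma exp_mul_iter_expm1_mul x k s :
  exp_mul x (iter k expm1_mul s) = iter k expm1_mul (exp_mul x s).
Proof. by elim: k => //= k IH; rewrite exp_mul_expm1_mul IH. Qed.

Lemma expm1_mulZ (a : C) s :
  expm1_mul (fun n => a *: s n) = fun n => a *: expm1_mul s n.
Proof.
rewrite /expm1_mul exp_mulZ.
by apply: functional_extensionality => n; rewrite scalerBr.
Qed.

Lemma iter_expm1_mulZ (a : C) k s :
  iter k expm1_mul (fun n => a *: s n) = fun n => a *: iter k expm1_mul s n.
Proof. by elim: k => //= k ->; rewrite expm1_mulZ. Qed.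

Lemma expm1_mul0 s : expm1_mul s 0 = 0.
Proof.
by rewrite /expm1_mul /exp_mul big_ord1 subn0 exp_coef0 scale1r subrr.
Qed.

Lemma expm1_mulS s n :
  expm1_mul s n.+1 = \sum_(i < n.+1) exp_coef 1 i.+1 *: s (n - i)%N.
Proof.
rewrite /expm1_mul /exp_mul big_ord_recl /= subn0 exp_coef0 scale1r addrC addKr.
by apply: eq_bigr => i _.
Qed.

Lemma iter_expm1_mul_lt k s n : (n < k)%N -> iter k expm1_mul s n = 0.
Proof.
elim: k n => [|k IH] [|n] //= ltnk; first by rewrite expm1_mul0.
rewrite expm1_mulS big1 // => i _; rewrite IH ?scaler0 //.
by apply: leq_ltn_trans (leq_subr _ _) _.
Qed.

(** As [e^z - 1 = z + ...], coefficient [n + 1] of the product determines coefficient [n] of the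
    factor, given the earlier ones. *)
Lemma expm1_mul_inj : injective expm1_mul.
Proof.
move=> s t eq_st; apply: functional_extensionality => n.
elim/ltn_ind: n => n IH; have := congr1 (fun f => f n.+1) eq_st.
rewrite !expm1_mulS !big_ord_recl /= !subn0 /exp_coef expr1n divr1 !scale1r.
move=> eq_n; apply: (addIr _ (etrans eq_n _)); congr (_ + _).
apply: eq_bigr => i _; congr (_ *: _); apply/esym/IH.
by rewrite /bump /=; move: (ltn_ord i); lia.
Qed.

(* The substitution [z := -z]. *)
Definition negz s (n : nat) : W := (-1) ^+ n *: s n.

Lemma negz_exp_mul x s : negz (exp_mul x s) = exp_mul (- x) (negz s).
Proof.
apply: functional_extensionality => n; rewrite /negz /exp_mul scaler_sumr.
apply: eq_bigr => i _; rewrite !scalerA /exp_coef [(- x) ^+ i]exprNn.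
congr (_ *: _); have le_in : (i <= n)%N by rewrite -ltnS.
rewrite -{1}(subnK le_in) exprD; ring.
Qed.

Lemma negz_iter_shiftz d s :
  negz (iter d shiftz s) = fun n => (-1) ^+ d *: iter d shiftz (negz s) n.
Proof.
apply: functional_extensionality => n; rewrite /negz.
case: (ltnP n d) => [lt_nd|le_dn]; first by rewrite !iter_shiftz_lt // !scaler0.
by rewrite -(subnK le_dn) !iter_shiftzD exprD mulrC scalerA.
Qed.

(* [e^{kz} (e^{-z} - 1)^k = (-1)^k (e^z - 1)^k] *)
Lemma exp_mul_negz_expm1_mul x k s :
  exp_mul (x + k%:R) (negz (iter k expm1_mul s)) =
  fun n => (-1) ^+ k *: iter k expm1_mul (exp_mul x (negz s)) n.
Proof.
elim: k => [|k IH].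
  by rewrite addr0; apply: functional_extensionality => n; rewrite scale1r.
have -> : negz (iter k.+1 expm1_mul s) = fun n =>
    exp_mul (- 1) (negz (iter k expm1_mul s)) n - negz (iter k expm1_mul s) n.
  apply: functional_extensionality => n.
  by rewrite -negz_exp_mul /negz /= /expm1_mul scalerBr.
rewrite exp_mulB exp_mulD -natr1.
have -> : x + (k%:R + 1) - 1 = x + k%:R by ring.
have -> : x + (k%:R + 1) = 1 + (x + k%:R) by ring.
rewrite -[exp_mul (1 + _) _]exp_mulD IH exp_mulZ.
apply: functional_extensionality => n.
by rewrite exprS mulN1r scaleNr /= /expm1_mul scalerBr opprB.
Qed.

(** Multiplication by [e^z - 1] and by [x1 - x2] both become forward differences, so this one
    expansion serves for the powers of both. *)
Lemma iter_diff (f : nat -> W) k j :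
  iter k (fun (g : nat -> W) i => g i.+1 - g i) f j =
  \sum_(i < k.+1) ('C(k, i)%:R * (-1) ^+ (k - i)) *: f (j + i)%N.
Proof.
elim: k j => [|k IH] j; first by rewrite big_ord1 mulr1 scale1r addn0.
rewrite iterS !IH.
have -> : \sum_(i < k.+1) ('C(k, i)%:R * (-1) ^+ (k - i)) *: f (j + i)%N =
    \sum_(i < k.+2) ('C(k, i)%:R * (-1) ^+ (k - i)) *: f (j + i)%N.
  by rewrite [RHS]big_ord_recr /= bin_small // mul0r scale0r addr0.
rewrite !(big_ord_recl k.+1) /= !bin0 !subn0 opprD addrCA -sumrB.
congr (_ + _); first by rewrite !mul1r exprS mulN1r scaleNr.
apply: eq_bigr => i _; rewrite /bump /= add1n addSnnS subSS binS natrD.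
rewrite -scalerBl; congr (_ *: _); rewrite mulrDl addrC -mulrN; congr (_ + _).
have [lt_ik|le_ki] := ltnP i k; last by rewrite bin_small ?mul0r.
by rewrite -(subnSK lt_ik) exprS mulN1r.
Qed.

(** On the family [e^{jz} s], multiplication by [e^z - 1] is the forward difference in [j]. *)
Lemma iter_expm1_mulE k s n :
  iter k expm1_mul s n = \sum_(i < n.+1) expm1_coef C k i *: s (n - i)%N.
Proof.
have iterE j : iter k expm1_mul (exp_mul j%:R s) n =
    iter k (fun (g : nat -> W) i => g i.+1 - g i)
      (fun i => exp_mul i%:R s n) j.
  elim: k j => //= k IH j.
  by rewrite -!IH {1}/expm1_mul exp_mul_iter_expm1_mul exp_mulD nat1r.
have := iterE 0%N; rewrite exp_mul0 iter_diff => ->.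
rewrite /exp_mul; under eq_bigr => j _ do rewrite add0n scaler_sumr.
rewrite exchange_big /=; apply: eq_bigr => i _; rewrite /expm1_coef mulr_suml.
rewrite scaler_suml; apply: eq_bigr => j _.
by rewrite scalerA /exp_coef mulrA.
Qed.

End PowerSeries.

(** * Laurent series in a fixed total degree and the substitution [x1 = x2 e^z] *)

Section LaurentCoefficients.
Variables (C : numClosedFieldType) (W : lmodType C).
Implicit Types (f g F G : int -> W) (r : seq int) (c : nat -> W).

Definition int_range (lo : int) (n : nat) : seq int :=
  [seq lo + i%:Z | i <- iota 0 n].

Lemma mem_int_range lo n a : (a \in int_range lo n) = (lo <= a < lo + n%:Z).
Proof.
apply/mapP/idP => [[i]|/andP[le_la lt_an]].
  by rewrite mem_iota => lt_in ->; lia.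
by exists (absz (a - lo)); rewrite ?mem_iota; lia.
Qed.

Lemma int_range_uniq lo n : uniq (int_range lo n).
Proof. by rewrite map_inj_uniq ?iota_uniq // => i j; lia. Qed.

Lemma seq_int_lower_bound r : exists lo : int, forall b, b \in r -> lo <= b.
Proof.
elim: r => [|x r [lo IH]]; first by exists 0.
exists (Num.min x lo) => b; rewrite inE => /predU1P[->|/IH]; lia.
Qed.

Definition supported r F : Prop :=
  uniq r /\ forall a, a \notin r -> F a = 0.

Lemma supported_cat_l r r' F : supported r F -> supported (undup (r ++ r')) F.
Proof.
case=> _ F0; split=> [|a]; rewrite ?undup_uniq // mem_undup mem_cat negb_or.
by case/andP=> /F0.
Qed.

Lemma supported_cat_r r r' F : supported r' F -> supported (undup (r ++ r')) F.
Proof.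
case=> _ F0; split=> [|a]; rewrite ?undup_uniq // mem_undup mem_cat negb_or.
by case/andP=> _ /F0.
Qed.

Lemma eq_sum_supported (h : int -> C) F r r' :
  supported r F -> supported r' F ->
  \sum_(b <- r) h b *: F b = \sum_(b <- r') h b *: F b.
Proof.
move=> [Ur Fr] [Ur' Fr'].
have nzE s : \sum_(b <- s) h b *: F b =
    \sum_(b <- [seq b <- s | F b != 0]) h b *: F b.
  rewrite (bigID (fun b => F b != 0)) /= [X in _ + X]big1 ?addr0 ?big_filter //.
  by move=> b /negPn/eqP->; rewrite scaler0.
rewrite nzE [RHS]nzE; apply: perm_big.
apply: uniq_perm; rewrite ?filter_uniq // => b; rewrite !mem_filter.
case: (eqVneq (F b) 0) => //= Fb0.
have inr s : (forall a, a \notin s -> F a = 0) -> b \in s.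
  by move=> Fs; apply: contraNT Fb0 => /Fs/eqP.
by rewrite !inr.
Qed.

(* The series [\sum_b e^{b z} F b]: for [F b] the coefficient of            *)
(* [x1^b x2^{p-b}], this is the coefficient of [x2^p] after [x1 := x2 e^z]. *)
Definition moments r F (q : nat) : W :=
  \sum_(b <- r) exp_coef b%:~R q *: F b.

Lemma eq_moments F r r' : supported r F -> supported r' F ->
  moments r F = moments r' F.
Proof.
by move=> Fr Fr'; apply: functional_extensionality => q; apply: eq_sum_supported.
Qed.

Lemma exp_mul_moments x r F :
  exp_mul x (moments r F) =
  fun q => \sum_(b <- r) exp_coef (x + b%:~R) q *: F b.
Proof.
apply: functional_extensionality => q; rewrite /exp_mul /moments.
under eq_bigr => i _ do rewrite scaler_sumr.
rewrite exchange_big /=; apply: eq_bigr => b _; rewrite exp_coefD scaler_suml.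
by apply: eq_bigr => i _; rewrite scalerA.
Qed.

(* Multiplication by [x1 - x2] inside a fixed total degree, where a function *)
(* of [a] records the coefficients of [x1^a].                                *)
Definition xsub f (a : int) : W := f (a - 1) - f a.

Lemma xsubE f a : xsub f a = f (a - 1) - f a.
Proof. by []. Qed.

Lemma iter_xsubE k f a :
  iter k xsub f a =
  \sum_(i < k.+1) ('C(k, i)%:R * (-1) ^+ i) *: f (a - (k - i)%N%:Z).
Proof.
have iterE j : iter k xsub f (a - j%:Z) =
    iter k (fun (g : nat -> W) i => g i.+1 - g i) (fun i => f (a - i%:Z)) j.
  elim: k j => //= k IH j; rewrite -!IH xsubE; congr (iter k _ f _ - _); lia.
have := iterE 0%N; rewrite subr0 iter_diff => ->.
rewrite (reindex_inj rev_ord_inj) /=; apply: eq_bigr => i _.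
have le_ik : (i <= k)%N by rewrite -ltnS.
by rewrite subSS bin_sub // subKn.
Qed.

(** Exchanging [x1] and [x2] multiplies [(x1 - x2)^k] by [(-1)^k]; the product has total degree
    [p + k], hence the shifted reflection. *)
Lemma iter_xsub_reflect k f (p a : int) :
  iter k xsub (fun b => f (p - b)) a =
  (-1) ^+ k *: iter k xsub f (p + k%:Z - a).
Proof.
elim: k a => [|k IH] a /=; first by rewrite scale1r addr0.
rewrite xsubE !IH exprS mulN1r scaleNr -scalerBr -scalerN; congr (_ *: _).
rewrite xsubE [RHS]opprB; congr (_ - _); congr (iter k _ _ _); lia.
Qed.

Lemma iter_xsub_vanish_ge k f (N : int) :
  (forall a, N <= a -> f a = 0) ->
  forall a, N + k%:Z <= a -> iter k xsub f a = 0.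
Proof.
move=> f0; elim: k => [|k IH] a le_a /=; first by apply: f0; lia.
by rewrite xsubE !IH ?subr0 //; lia.
Qed.

Lemma supported_xsub r F : supported r F ->
  supported (undup ([seq b + 1 | b <- r] ++ r)) (xsub F).
Proof.
move=> [_ F0]; split=> [|a]; rewrite ?undup_uniq // mem_undup mem_cat negb_or.
case/andP=> a1 /F0; rewrite /xsub => ->; rewrite F0 ?subr0 //.
by apply: contra a1 => ra; apply/mapP; exists (a - 1); rewrite ?subrK.
Qed.

(** The substitution turns [x1 - x2] into [x2 (e^z - 1)]. *)
Lemma moments_xsub r r' F : supported r F -> supported r' (xsub F) ->
  moments r' (xsub F) = expm1_mul (moments r F).
Proof.
move=> Fr Fr'; set r1 := [seq b + 1 | b <- r].
have Fr1 : supported r1 (fun a => F (a - 1)).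
  case: Fr => Ur F0; split=> [|a a1].
    by rewrite map_inj_uniq // => i j; lia.
  by apply: F0; apply: contra a1 => ra; apply/mapP; exists (a - 1); rewrite ?subrK.
rewrite (eq_moments Fr' (supported_xsub Fr)) -/r1.
apply: functional_extensionality => q; rewrite /expm1_mul exp_mul_moments.
have -> : \sum_(b <- r) exp_coef (1 + b%:~R) q *: F b =
    moments r1 (fun a => F (a - 1)) q.
  rewrite /moments big_map; apply: eq_bigr => b _.
  by rewrite addrK addrC intrD.
rewrite (eq_moments Fr1 (supported_cat_l r Fr1)).
rewrite (eq_moments Fr (supported_cat_r r1 Fr)) /moments -sumrB.
by apply: eq_bigr => b _; rewrite -scalerBr.
Qed.

Lemma xsub_telescope G a n :
  \sum_(b <- int_range (a + 1) n) xsub G b = G a - G (a + n%:Z).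
Proof.
rewrite /int_range big_map -{1}[n]subn0 -/(index_iota 0 n) big_mkord.
elim: n => [|n IH]; first by rewrite big_ord0 addr0 subrr.
rewrite big_ord_recr /= IH /xsub addrA.
have -> : a + 1 + n%:Z - 1 = a + n%:Z by lia.
have -> : a + 1 + n%:Z = a + n.+1%:Z by lia.
by rewrite subrK.
Qed.

(** A Laurent polynomial that vanishes at [x1 = x2] is divisible by [x1 - x2]; the quotient is [G]
    because [G] vanishes for large exponents. *)
Lemma supported_of_xsub r G (N : int) :
  (forall a, N <= a -> G a = 0) -> supported r (xsub G) ->
  \sum_(b <- r) xsub G b = 0 -> exists r', supported r' G.
Proof.
move=> G0 Gr sum0; have [lo lo_r] := seq_int_lower_bound r.
have G0' a : a < lo -> G a = 0.
  (* The [n] terms from [a + 1] on cover the support of [xsub G] and telescope to a point where [G]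
     vanishes, so [G a] is the total, which is zero. *)
  move=> lt_a; set n := absz (N - a).
  have Gn : supported (int_range (a + 1) n) (xsub G).
    split=> [|b]; rewrite ?int_range_uniq // mem_int_range negb_and.
    case/orP=> [lt_b|le_b].
      by apply: (proj2 Gr); apply/negP => /lo_r; lia.
    by rewrite /xsub !G0 ?subr0 //; rewrite /n in le_b; lia.
  have := eq_sum_supported (fun=> 1) Gn Gr.
  under eq_bigr => b _ do rewrite scale1r.
  under [in RHS]eq_bigr => b _ do rewrite scale1r.
  rewrite sum0 xsub_telescope [G (a + _)]G0 ?subr0 // /n; lia.
exists (int_range lo (absz (N - lo))); split=> [|a]; rewrite ?int_range_uniq //.
rewrite mem_int_range negb_and => /orP[lt_a|le_a]; first by apply: G0'; lia.
by have [lt_a|le_la] := ltP a lo; [apply: G0' | apply: G0; lia].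
Qed.

(* Linear independence of the exponentials [e^{b z}]: interpolate at the     *)
(* points of the support.                                                    *)
Lemma moments_inj r r' F G : supported r F -> supported r' G ->
  moments r F = moments r' G -> F = G.
Proof.
move=> Fr Gr'; set s := undup (r ++ r').
have Fs : supported s F by apply: supported_cat_l.
have Gs : supported s G by apply: supported_cat_r.
rewrite (eq_moments Fr Fs) (eq_moments Gr' Gs) => eqFG.
(* Weighting coefficient [q] by [q! h_q] and summing replaces each [e^{bz}] by [h(b)]. *)
have polyH (h : {poly C}) : \sum_(b <- s) h.[b%:~R] *: (F b - G b) = 0.
  under eq_bigr => b _ do rewrite horner_coef scaler_suml.
  rewrite exchange_big big1 // => q _ /=.
  have := congr1 (fun m : nat -> W => (h`_q * q`!%:R) *: (m q)) eqFG.
  rewrite /moments /= !scaler_sumr => /eqP; rewrite -subr_eq0 -sumrB => /eqP Eq.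
  rewrite -[RHS]Eq; apply: eq_bigr => b _.
  rewrite !scalerA -scalerBr /exp_coef mulrA; congr (_ *: _).
  by have := factR_neq0 C q => ?; field.
apply: functional_extensionality => a; apply/eqP; rewrite -subr_eq0; apply/eqP.
case: (boolP (a \in s)) => [sa|s'a].
  have := polyH (\prod_(b <- s | b != a) ('X - (b%:~R)%:P)).
  rewrite (bigD1_seq a) //=; last exact: (proj1 Fs).
  rewrite [X in _ + X]big1_seq ?addr0; last first.
    move=> b /andP[ba sb]; rewrite horner_prod (big_rem b) //= ba.
    by rewrite hornerXsubC subrr mul0r scale0r.
  move/eqP; rewrite scaler_eq0 => /orP[|/eqP//].
  rewrite horner_prod prodf_seq_eq0 => /hasP[b sb /andP[ba]].
  by rewrite hornerXsubC subr_eq0 eqr_int eq_sym (negPf ba).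
by rewrite (proj2 Fs) // (proj2 Gs) // subrr.
Qed.

End LaurentCoefficients.

(** * Changing the exponent [k], exchanging the variables, and residues *)

Section CoordinatedExpansion.
Variables (C : numClosedFieldType) (W : lmodType C).
Implicit Types (f g F G : int -> W) (r : seq int) (c : nat -> W).

(* [(x1 - x2)^k f] is a Laurent polynomial whose value at [x1 = x2 e^z],    *)
(* multiplied by [z^d], is [(e^z - 1)^k c]; here [c] stands for             *)
(* [z^d Y_W(Y(u,z)v, x2)].                                                  *)
Definition coordinated (d k : nat) f c : Prop :=
  exists r, supported r (iter k (@xsub C W) f) /\
    iter d (@shiftz C W) (moments r (iter k (@xsub C W) f)) =
    iter k (@expm1_mul C W) c.

Lemma coordinatedS d k f c : coordinated d k f c -> coordinated d k.+1 f c.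
Proof.
case=> r [fr Er]; exists (undup ([seq b + 1 | b <- r] ++ r)).
have fr' := supported_xsub fr; split=> //.
by rewrite !iterS (moments_xsub fr fr') -expm1_mul_iter_shiftz Er.
Qed.

(** At [z = 0] the polynomial [(x1 - x2)^{k+1} f] takes as value the coefficient of [z^d] in
    [(e^z - 1)^{k+1} c], zero since [d <= k]. So it is divisible by [x1 - x2], and a factor
    [e^z - 1] cancels. *)
Lemma coordinated_pred d k f c (N : int) :
  (forall a, N <= a -> f a = 0) -> (d <= k)%N ->
  coordinated d k.+1 f c -> coordinated d k f c.
Proof.
move=> f0 le_dk [r [fr Er]].
have [r' fr'] : exists r', supported r' (iter k (@xsub C W) f).
  apply: (supported_of_xsub (iter_xsub_vanish_ge (k := k) f0) fr).
  have := iter_shiftzD d (moments r (iter k.+1 (@xsub C W) f)) 0.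
  rewrite add0n Er iter_expm1_mul_lt // => E0; rewrite [RHS]E0.
  by apply: eq_bigr => b _; rewrite exp_coef0 scale1r.
exists r'; split=> //; apply: (@expm1_mul_inj C W).
by rewrite expm1_mul_iter_shiftz -iterS -Er -(moments_xsub fr' fr).
Qed.

(** The exponent in the module axiom depends on the pair of vectors; moving it to [d] makes [(u,v)]
    and [(v,u)] comparable. *)
Lemma coordinated_at_order d k f c (N : int) :
  (forall a, N <= a -> f a = 0) -> coordinated d k f c -> coordinated d d f c.
Proof.
move=> f0; have [le_dk|/ltnW le_kd] := leqP d k.
  rewrite -(subnK le_dk); elim: (k - d)%N => // n IH Hn; apply: IH.
  by apply: coordinated_pred f0 _ Hn; rewrite leq_addl.
have up n : coordinated d k f c -> coordinated d (n + k) f c.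
  by elim: n => // n IH /IH; apply: coordinatedS.
by rewrite -{3}(subnK le_kd); apply: up.
Qed.

(** For [F] homogeneous of degree [p + k], [F(x2, x1)] at [x1 = x2 e^z] is [e^{(p+k)z}] times
    [F(x1, x2)] at [x1 = x2 e^{-z}]. The factor [e^{kz}] turns [(e^{-z} - 1)^k] into
    [(-1)^k (e^z - 1)^k], and [(-1)^d] comes from [z^d]. *)
Lemma coordinated_reflect d k f c (p : int) : coordinated d k f c ->
  coordinated d k (fun a => f (p - a))
    (fun n => (-1) ^+ d *: exp_mul p%:~R (negz c) n).
Proof.
case=> r [[Ur f0] Er]; exists [seq p + k%:Z - b | b <- r]; split.
  split=> [|a ra]; first by rewrite map_inj_uniq // => i j; lia.
  rewrite iter_xsub_reflect f0 ?scaler0 //.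
  by apply: contra ra => ra; apply/mapP; eexists; [exact: ra | lia].
have -> : moments [seq p + k%:Z - b | b <- r]
      (iter k (@xsub C W) (fun a => f (p - a))) =
    fun n => (-1) ^+ k *:
      exp_mul (p%:~R + k%:R) (negz (moments r (iter k (@xsub C W) f))) n.
  have -> : negz (moments r (iter k (@xsub C W) f)) = fun n =>
      \sum_(b <- r) exp_coef (- b%:~R) n *: iter k (@xsub C W) f b.
    apply: functional_extensionality => n; rewrite /negz scaler_sumr.
    by apply: eq_bigr => b _; rewrite scalerA /exp_coef [in RHS]exprNn mulrA.
  apply: functional_extensionality => n; rewrite /moments big_map.
  rewrite /exp_mul; under [in RHS]eq_bigr => i _ do rewrite scaler_sumr.
  rewrite exchange_big scaler_sumr; apply: eq_bigr => b _ /=.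
  under eq_bigr => i _ do rewrite scalerA.
  rewrite -scaler_suml -exp_coefD iter_xsub_reflect.
  rewrite !scalerA mulrC opprB addrCA subrr addr0.
  by congr (_ * exp_coef _ _ *: _); rewrite intrB intrD.
have shiftzZ (a : C) s : iter d (@shiftz C W) (fun n => a *: s n) =
    fun n => a *: iter d (@shiftz C W) s n.
  apply: functional_extensionality => n; case: (ltnP n d) => [lt_nd|le_dn].
    by rewrite !iter_shiftz_lt ?scaler0.
  by rewrite -(subnK le_dn) !iter_shiftzD.
rewrite shiftzZ iter_expm1_mulZ.
have exp_shiftz x s : iter d (@shiftz C W) (exp_mul x s) =
    exp_mul x (iter d (@shiftz C W) s).
  by elim: (d) => //= e ->; rewrite exp_mul_shiftz.
have -> : iter d (@shiftz C W) (exp_mul (p%:~R + k%:R)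
      (negz (moments r (iter k (@xsub C W) f)))) = fun n => (-1) ^+ d *:
    exp_mul (p%:~R + k%:R) (negz (iter k (@expm1_mul C W) c)) n.
  rewrite exp_shiftz -Er negz_iter_shiftz exp_mulZ.
  by apply: functional_extensionality => n; rewrite scalerA -expr2 sqrr_sign scale1r.
rewrite exp_mul_negz_expm1_mul; apply: functional_extensionality => n.
by rewrite !scalerA mulrCA -expr2 sqrr_sign mulr1.
Qed.

(** The kernel of [xsub] consists of the constant functions; vanishing on one side leaves only
    zero. *)
Lemma xsub_inj_ge f g (N : int) :
  (forall a, N <= a -> f a = 0) -> (forall a, N <= a -> g a = 0) ->
  xsub f = xsub g -> f = g.
Proof.
move=> f0 g0 eq_fg; apply: functional_extensionality => a.
have := xsub_telescope f a (absz (N - a)).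
rewrite eq_fg xsub_telescope [f (a + _)]f0 ?[g (a + _)]g0 ?subr0 //; lia.
Qed.

Lemma xsub_inj_lt f g (N : int) :
  (forall a, a < N -> f a = 0) -> (forall a, a < N -> g a = 0) ->
  xsub f = xsub g -> f = g.
Proof.
move=> f0 g0 eq_fg; apply: functional_extensionality => a.
pose n := (absz (a - N)).+1; have := xsub_telescope f (a - n%:Z) n.
rewrite eq_fg xsub_telescope [f (a - _)]f0 ?[g (a - _)]g0 ?subrK ?sub0r.
- by move/oppr_inj.
- by rewrite /n; lia.
- by rewrite /n; lia.
Qed.

Lemma iter_xsub_inj_ge k f g (N : int) :
  (forall a, N <= a -> f a = 0) -> (forall a, N <= a -> g a = 0) ->
  iter k (@xsub C W) f = iter k (@xsub C W) g -> f = g.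
Proof.
move=> f0 g0; elim: k => //= k IH /(xsub_inj_ge _ _) eq_k; apply: IH.
apply: eq_k; [exact: (iter_xsub_vanish_ge f0) | exact: (iter_xsub_vanish_ge g0)].
Qed.

Lemma iter_xsub_inj_lt k f g (N : int) :
  (forall a, a < N -> f a = 0) -> (forall a, a < N -> g a = 0) ->
  iter k (@xsub C W) f = iter k (@xsub C W) g -> f = g.
Proof.
have vanish h j : (forall a, a < N -> h a = 0) ->
    forall a, a < N -> iter j (@xsub C W) h a = 0.
  move=> h0; elim: j => [|j IH] a lt_a /=; first exact: h0.
  by rewrite xsubE !IH ?subr0 //; lia.
move=> f0 g0; elim: k => //= k IH /(xsub_inj_lt _ _) eq_k; apply: IH.
by apply: eq_k; apply: vanish.
Qed.

(* [f] and [g] are the expansions of one rational function [F / (x1 - x2)^2] *)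
(* for large and for small [x1], so their difference is a residue.           *)
Lemma residue_order2 f g F r (N N' : int) :
  (forall a, N <= a -> f a = 0) -> (forall a, a < N' -> g a = 0) ->
  iter 2 (@xsub C W) f = F -> iter 2 (@xsub C W) g = F -> supported r F ->
  forall a, f a - g a = moments r F 1 - (a + 1)%:~R *: moments r F 0.
Proof.
move=> f0 g0 fF gF Fr.
(* [ramp n] is the coefficient of [x1^{-n} x2^{n-2}] in [(x1 - x2)^{-2}] expanded for large [x1];
   [R] is [Q] without the truncation at 0. *)
pose ramp (n : int) : C := (Num.max (n - 1) 0)%:~R.
pose Q (a : int) := \sum_(b <- r) ramp (b - a) *: F b.
pose R (a : int) := \sum_(b <- r) (b - a - 1)%:~R *: F b.
have RE a : R a = moments r F 1 - (a + 1)%:~R *: moments r F 0.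
  rewrite /R /moments scaler_sumr -sumrB; apply: eq_bigr => b _.
  rewrite exp_coef0 scalerA mulr1 -scalerBl /exp_coef divr1 expr1 -intrB.
  by congr (_%:~R *: _); lia.
have QF : iter 2 (@xsub C W) Q = F.
  apply: functional_extensionality => a; rewrite /= !xsubE /Q -!sumrB.
  case: Fr => Ur F0.
  transitivity (\sum_(b <- r) (if b == a then F b else 0)).
    apply: eq_bigr => b _; rewrite -!scalerBl.
    have -> : ramp (b - (a - 1 - 1)) - ramp (b - (a - 1)) -
        (ramp (b - (a - 1)) - ramp (b - a)) = (b == a)%:R.
      rewrite /ramp -!intrB [RHS]pmulrn; congr (_%:~R).
      by case: eqVneq => [->|]; lia.
    by case: (b == a); rewrite ?scale1r ?scale0r.
  rewrite -big_mkcond /=; case: (boolP (a \in r)) => [ra|/[dup] ra /F0->].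
    by rewrite (big_rem a) //= eqxx big1_seq ?addr0 // => b /andP[/eqP->];
       rewrite mem_rem_uniq // inE eqxx.
  by rewrite big1_seq // => b /andP[/eqP-> rb]; rewrite rb in ra.
have [lo lo_r] := seq_int_lower_bound r.
have [hi hi_r] := seq_int_lower_bound [seq - b | b <- r].
have eq_fQ : f = Q.
  apply: (@iter_xsub_inj_ge 2 _ _ (Num.max N (- hi))); rewrite ?fF ?QF //.
    by move=> a le_a; apply: f0; lia.
  move=> a le_a; rewrite /Q big1_seq // => b /andP[_ rb].
  have := hi_r (- b) (map_f _ rb) => le_b.
  by rewrite /ramp (_ : Num.max _ _ = 0) ?scale0r //; lia.
(* [R] is affine in [a], hence killed by [xsub] twice, and [Q - R] vanishes for small [a]: it is the
   opposite expansion. *)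
have eq_gQ : g = fun a => Q a - R a.
  apply: (@iter_xsub_inj_lt 2 _ _ (Num.min N' lo)).
  - by move=> a lt_a; apply: g0; lia.
  - move=> a lt_a; rewrite /Q /R -sumrB big1_seq // => b /andP[_ rb].
    have := lo_r b rb => le_b; rewrite /ramp -scalerBl -intrB.
    by rewrite (_ : _ - _ = 0) ?scale0r //; lia.
  rewrite gF -[LHS]QF; apply: functional_extensionality => a.
  have affR : R (a - 1 - 1) - R (a - 1) - (R (a - 1) - R a) = 0.
    rewrite /R -!sumrB big1 // => b _; rewrite -!scalerBl -!intrB.
    by rewrite (_ : _ - _ = 0) ?scale0r //; lia.
  have subrACA (x y z t : W) : x - y - (z - t) = x - z - (y - t).
    by rewrite !opprB -!addrA; congr (_ + _); rewrite addrCA [RHS]addrC -addrA.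
  rewrite /= !xsubE [X in _ = X - _]subrACA [X in _ = _ - X]subrACA.
  by rewrite [RHS]subrACA affR subr0.
by move=> a; rewrite eq_fQ eq_gQ subKr RE.
Qed.

End CoordinatedExpansion.

(** * Consequences of linearity *)

Section LinearMaps.
Variables (C : numClosedFieldType) (M N : lmodType C) (f : M -> N).
Hypothesis linf : lin f.

Lemma lin_add x y : f (x + y) = f x + f y.
Proof. by have := linf 1 x y; rewrite !scale1r. Qed.

Lemma lin_zero : f 0 = 0.
Proof. by apply: (addrI (f 0)); rewrite -lin_add !addr0. Qed.

Lemma lin_scale (a : C) x : f (a *: x) = a *: f x.
Proof. by have := linf a x 0; rewrite !addr0 lin_zero addr0. Qed.

Lemma lin_sum (I : Type) (r : seq I) (P : pred I) (F : I -> M) :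
  f (\sum_(i <- r | P i) F i) = \sum_(i <- r | P i) f (F i).
Proof. exact: (big_morph f lin_add lin_zero). Qed.

End LinearMaps.

(** * Skew symmetry and the commutator formula *)

Section CoordinatedModules.
Variables (C : numClosedFieldType) (V : lmodType C).
Variables (Y : V -> V -> int -> V) (one : V).
Hypothesis HVA : vertex_algebra Y one.
Variables (W : lmodType C) (YW : V -> int -> W -> W).
Hypothesis HW : phi_coordinated_module Y one YW.

(** This is [Y(u,z)v = e^{zD} Y(v,-z)u], multiplied by [z^d] and read at [z^n], with [x_{-1-i} 1]
    for [D^i x / i!]. *)
Lemma skew_symmetry (u v : V) (d n : nat) :
  (forall m : int, d%:Z <= m -> Y v u m = 0) ->
  Y u v (d%:Z - 1 - n%:Z) =
  \sum_(i < n.+1) ((-1) ^+ d * (-1) ^+ (n - i)) *: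
    Y (Y v u (d%:Z - 1 - (n - i)%N%:Z)) one (-1 - (i : nat)%:Z).
Proof.
case: HVA => -[_ linY] _ [_ Yone] borcherds Yvu0.
set r := d%:Z - 1 - n%:Z.
have vanish (i : nat) : (n < i)%N ->
    [/\ Y v u (r + i%:Z) = 0, Y u one (0 + i%:Z) = 0 & Y v one (-1 + i%:Z) = 0].
  move=> lt_ni; split; first by apply: Yvu0; rewrite /r; lia.
    by apply: (proj2 (Yone u)); lia.
  by apply: (proj2 (Yone v)); lia.
(* With the vacuum as third vector, the right-hand side reduces to the term in [v_{-1} 1 = v], which
   is [u_r v] up to sign. *)
have := borcherds v u one (-1) 0 r n.+1 vanish.
rewrite [X in _ = X -> _]big_ord_recl [X in _ = _ + X -> _]big1 /=; last first.
  move=> i _; rewrite !(proj2 (Yone _)); try by rewrite /bump; lia.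
  by rewrite !(lin_zero (linY _ _)) scaler0 subrr scaler0.
rewrite addr0 (proj2 (Yone u) 0) // (proj1 (Yone v)).
rewrite (lin_zero (linY _ _)) /binz big_ord0 fact0 divr1 mulr1 scale1r.
rewrite !sub0r subr0 add0r !addr0 => E.
have -> : Y u v r = - (-1) ^+ absz r *: - ((-1) ^+ absz r *: Y u v r).
  by rewrite scalerN scaleNr opprK scalerA -expr2 sqrr_sign scale1r.
rewrite -E scaler_sumr; apply: eq_bigr => i _.
rewrite scalerA; have le_in : (i <= n)%N by rewrite -ltnS.
have -> : r + (i : nat)%:Z = d%:Z - 1 - (n - i)%N%:Z by rewrite /r; lia.
congr (_ *: _).
have -> : (\prod_(j < i) (-1 - j%:Z)%:~R) = (-1) ^+ i * i`!%:R :> C.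
  elim: (nat_of_ord i) => [|j IH]; first by rewrite big_ord0 mulr1.
  rewrite big_ord_recr /= IH factS natrM exprS intrB -[(j%:Z)%:~R]pmulrn -nat1r.
  by ring.
rewrite mulfK ?factR_neq0 //.
rewrite mulNr -!exprD -[LHS]mulN1r -exprS -[LHS]signr_odd -[RHS]signr_odd.
congr (_ ^+ _); congr (nat_of_bool _); rewrite /r; lia.
Qed.

Lemma module_coordinated (u v : V) (d : nat) (w : W) (p : int) :
  (forall m : int, d%:Z <= m -> Y u v m = 0) ->
  coordinated d d (fun a => YW u a (YW v (p - a) w))
    (fun n => YW (Y u v (d%:Z - 1 - n%:Z)) p w).
Proof.
move=> Yuv0; case: HW => linV linW trunc _ /(_ u v) [k [/(_ w) [N prod0] subst]].
set f := (fun a => _).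
have [N0 v0] := trunc v w.
have f0 a : p - N0 + 1 <= a -> f a = 0.
  by move=> le_a; rewrite /f v0 ?(lin_zero (linW _ _)) //; lia.
apply: (coordinated_at_order (k := k) f0).
have prodE a : prod_coef YW u v k w a (p + k%:Z - a) = iter k (@xsub C W) f a.
  rewrite iter_xsubE; apply: eq_bigr => i _; congr (_ *: YW u _ (YW v _ w)).
  by have := ltn_ord i; lia.
(* These are the [a] with [N <= a] and [N <= p + k - a]; when there are none, [nat_of_int] gives
   length 0. *)
exists (int_range N (nat_of_int (p + k%:Z - N - N + 1))); split.
  split=> [|a]; rewrite ?int_range_uniq // mem_int_range negb_and -prodE => out.
  apply: prod0; move: out.
  by case E : (p + k%:Z - N - N + 1) => [n|n] /=; lia.
apply: functional_extensionality => n; rewrite iter_expm1_mulE.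
have Yq0 (i : nat) : (n < i)%N -> Y u v (i%:Z - (n%:Z - d%:Z) - 1) = 0.
  by move=> lt_ni; apply: Yuv0; lia.
(* The degree is [p + k] because [(x2 e^z - x2)^k] contributes [x2^k]; the power of [z] is [n - d]
   because both sides carry an extra [z^d]. *)
have := subst w N prod0 (p + k%:Z) (n%:Z - d%:Z) n.+1 Yq0.
rewrite /lhs_coef => lhsE.
transitivity (\sum_(i < n.+1) expm1_coef C k i *:
  YW (Y u v ((i : nat)%:Z - (n%:Z - d%:Z) - 1)) (p + k%:Z - k%:Z) w); last first.
  apply: eq_bigr => i _; rewrite addrK; congr (_ *: YW (Y u v _) _ _).
  by have := ltn_ord i; lia.
rewrite lhsE; case: (ltnP n d) => [lt_nd|le_dn].
  by rewrite iter_shiftz_lt // ifT //; lia.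
rewrite ifF; last by lia.
have -> : absz (n%:Z - d%:Z) = (n - d)%N by lia.
rewrite -{1}(subnK le_dn) iter_shiftzD /moments /subst_coef /int_range big_map.
set m := nat_of_int _; rewrite -{1}[m]subn0.
rewrite -/(index_iota 0 m) big_mkord; apply: eq_bigr => i _.
by rewrite prodE.
Qed.

(** For the pair [(x, 1)] the pole order is 0, and since [Y_W(1,x2)] is the identity only the
    exponential [e^{pz}] remains. *)
Lemma module_derivative (x : V) (p : int) (j : nat) (w : W) :
  YW (Y x one (-1 - j%:Z)) p w = exp_coef p%:~R j *: YW x p w.
Proof.
case: HVA => _ _ [_ Yone] _; case: (HW) => _ linW _ YWone _.
have [r [fr Er]] := module_coordinated w p (proj2 (Yone x) : forall m : int, 0%:Z <= m -> _).
have := congr1 (fun s : nat -> W => s j) Er; rewrite /= sub0r => <-.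
rewrite (eq_moments (r' := [:: p]) fr) ?/moments ?big_seq1 /= ?subrr ?YWone //.
split=> // a; rewrite inE YWone => ap; rewrite ifF ?(lin_zero (linW _ _)) //.
by apply/negbTE; rewrite subr_eq0 eq_sym.
Qed.

Lemma module_commutator (u v : V) :
  (forall m : int, 2 <= m -> Y u v m = 0) ->
  (forall m : int, 2 <= m -> Y v u m = 0) ->
  forall (a b : int) (w : W),
  YW u a (YW v b w) - YW v b (YW u a w) =
  YW (Y u v 0) (a + b) w - a%:~R *: YW (Y u v 1) (a + b) w.
Proof.
move=> Yuv0 Yvu0 a b w; set p := a + b.
case: (HW) => linV linW trunc _ _.
pose c (n : nat) := YW (Y u v (2%:Z - 1 - n%:Z)) p w.
pose f (a : int) := YW u a (YW v (p - a) w).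
pose g (a : int) := YW v (p - a) (YW u a w).
have [r [fr Er]] : coordinated 2 2 f c := module_coordinated w p Yuv0.
have [r' [gr Er']] : coordinated 2 2 g c.
  (* Skew symmetry identifies the reflected series with [c]: the factor [e^{pz}] is [e^{zD}] seen in
     degree [p]. *)
  have := coordinated_reflect p (module_coordinated w p Yvu0).
  rewrite (_ : (fun a => _) = g); last first.
    by apply: functional_extensionality => x; rewrite /g subKr.
  rewrite (_ : (fun n => _) = c) //; apply: functional_extensionality => n.
  rewrite /c (skew_symmetry n Yvu0) (lin_sum (linV _ _)) scaler_sumr.
  apply: eq_bigr => i _; rewrite (lin_scale (linV _ _)) module_derivative.
  by rewrite !scalerA; congr (_ *: _); ring.
have eqm : moments r (iter 2 (@xsub C W) f) = moments r' (iter 2 (@xsub C W) g).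
  apply: functional_extensionality => n.
  by rewrite -!(iter_shiftzD 2 (moments _ _)) Er Er'.
have eq2 := moments_inj fr gr eqm.
have [Nv v0] := trunc v w; have [Nu u0] := trunc u w.
have f0 x : p - Nv + 1 <= x -> f x = 0.
  by move=> le_x; rewrite /f v0 ?(lin_zero (linW _ _)) //; lia.
have g0 x : x < Nu -> g x = 0.
  by move=> lt_x; rewrite /g u0 ?(lin_zero (linW _ _)).
have := residue_order2 f0 g0 (erefl _) (esym eq2) fr a.
(* As [(e^z - 1)^2 = z^2 + z^3 + ...], moments 0 and 1 are [c 0] and [c 1 + c 0], with [c 0] from
   [u_1 v] and [c 1] from [u_0 v]. The extra [c 0] turns [a + 1] into [a]. *)
have cE n : moments r (iter 2 (@xsub C W) f) n =
    \sum_(i < (n + 2).+1) expm1_coef C 2 i *: c (n + 2 - i)%N.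
  by rewrite -(iter_shiftzD 2) Er iter_expm1_mulE.
have eE i : expm1_coef C 2 i = (0 ^+ i - 2 + 2 ^+ i) / i`!%:R.
  rewrite /expm1_coef !big_ord_recr big_ord0 /= bin0 bin1 binn expr1n.
  rewrite -[(2 - 0)%N]/2%N -[(2 - 1)%N]/1%N -[(2 - 2)%N]/0%N.
  by congr (_ / _); ring.
have e0 : expm1_coef C 2 0 = 0 by rewrite eE fact0; field.
have e1 : expm1_coef C 2 1 = 0 by rewrite eE factS fact0; field.
have e2 : expm1_coef C 2 2 = 1 by rewrite eE !factS fact0; field.
have e3 : expm1_coef C 2 3 = 1 by rewrite eE !factS fact0; field.
rewrite /f /g !cE !big_ord_recr big_ord0 /= e0 e1 e2 e3 !scale0r !scale1r !add0r.
have -> : p - a = b by rewrite /p addrAC subrr add0r.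
move=> ->.
rewrite /c big_ord0 !add0r intrD scalerDl scale1r.
have -> : 2%:Z - 1 - (1 + 2 - 2)%N%:Z = 0 by [].
have -> : 2%:Z - 1 - (1 + 2 - (1 + 2))%N%:Z = 1 by [].
by rewrite opprD addrACA subrr addr0.
Qed.

End CoordinatedModules.

(** * The bracket of two generating fields *)

Section GeneratorCommutator.
Variables (C : numClosedFieldType) (V : lmodType C).
Variables (Y : V -> V -> int -> V) (one : V).
Hypothesis HVA : vertex_algebra Y one.
Variables (W : lmodType C) (YW : V -> int -> W -> W).
Hypothesis HW : phi_coordinated_module Y one YW.

(** Covers the [T]-[E] and [E]-[E] brackets at once. The term [m x_{-2} 1] of [u_0 v] acts with
    factor [-m(n + s)], and [n(r + m)] from [u_1 v] completes it to [nr - ms]. *)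
Lemma generator_commutator (u v x : V) (m r : int) (k1 k2 : C) :
  (forall n : int, 0 <= n -> Y u v n =
      (n * r + m)%:~R *: Y x one (n - 2)
    + (m%:~R * dlt C ((m + r == 0) && (n == 0)) * k1) *: one
    + (n%:~R * dlt C ((m + r == 0) && (n == 1)) * k2) *: one) ->
  (forall n : int, 2 <= n -> Y v u n = 0) ->
  forall (n s : int) (w : W),
  YW u (- n) (YW v (- s) w) - YW v (- s) (YW u (- n) w) =
    (if nz (m + r) (n + s)
     then (n * r - m * s)%:~R *: YW x (- (n + s)) w else 0)
  + dlt C ((m + r == 0) && (n + s == 0)) *:
      (m%:~R *: (k1 *: w) + n%:~R *: (k2 *: w)).
Proof.
case: (HVA) => _ _ [_ Yone] _; case: (HW) => linV _ _ YWone _.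
move=> Yuv Yvu0 n s w.
have Yuv0 (j : int) : 2 <= j -> Y u v j = 0.
  move=> le_2j; rewrite Yuv; last by lia.
  rewrite (proj2 (Yone x)) ?scaler0; last by lia.
  have -> : (j == 0) = false by lia.
  have -> : (j == 1) = false by lia.
  by rewrite andbF /dlt /= !mulr0 !mul0r !scale0r !addr0.
rewrite (module_commutator HVA HW Yuv0 Yvu0) -opprD !Yuv //.
rewrite !(lin_add (linV _ _), lin_scale (linV _ _)) YWone oppr_eq0.
rewrite [1 - 2 : int](_ : _ = -1) // (proj1 (Yone x)).
have -> : 0 - 2 = -1 - 1%:Z :> int by [].
rewrite (module_derivative HVA HW) /exp_coef expr1 divr1.
rewrite !eqxx !andbT !andbF /dlt /=; set X := YW x _ w.
have nzE : nz (m + r) (n + s) = ~~ ((m + r == 0) && (n + s == 0)) by [].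
rewrite nzE !mulr0 !mul0r !scale0r !addr0 add0r !mul1r intrN scaleNr opprK.
have -> : m%:~R *: ((- (n + s))%:~R *: X) = (- (m * (n + s)))%:~R *: X.
  by rewrite scalerA -intrM mulrN.
have -> : n%:~R *: ((r + m)%:~R *: X + ((m + r == 0)%:R * k2) *:
    (if n + s == 0 then w else 0)) = (n * (r + m))%:~R *: X +
    ((m + r == 0)%:R * (n%:~R * k2)) *: (if n + s == 0 then w else 0).
  by rewrite scalerDr !scalerA -intrM mulrCA.
rewrite addrACA -scalerDl -intrD.
have -> : - (m * (n + s)) + n * (r + m) = n * r - m * s by ring.
case: (eqVneq (m + r) 0) => [mr0|_] /=; last first.
  by rewrite mulr0 !mul0r !scale0r !addr0.
case: (eqVneq (n + s) 0) => [ns0|_] /=; last by rewrite !scaler0 scale0r !addr0.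
(* At index [(0,0)] the coefficient vanishes, in agreement with the convention for the omitted
   term. *)
have -> : n * r - m * s = 0.
  have -> : r = - m by lia.
  have -> : s = - n by lia.
  by ring.
by rewrite scale0r !scale1r mulr1 mul1r !scalerA.
Qed.

End GeneratorCommutator.

(** * The [L^*]-module structure on [W] *)

Theorem theorem4p6 (C : numClosedFieldType) (l : 'I_4 -> C)
    (V : lmodType C) (tT tE : int -> int -> V -> V) (tK : 'I_4 -> V -> V)
    (one : V) (Y : V -> V -> int -> V)
    (HV : induced_vacuum_module l tT tE tK one)
    (HVA : vertex_algebra Y one)
    (HYT : forall m n v, Y (tT m (-1) one) v n = tT m n v)
    (HYE : forall m n v, Y (tE m (-1) one) v n = tE m n v)
    (W : lmodType C) (YW : V -> int -> W -> W)
    (HW : phi_coordinated_module Y one YW) :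
  restricted_Lstar_module_of_level l
    (fun m n => YW (tT m (-1) one) (- n))
    (fun m n => YW (tE m (-1) one) (- n)).
Proof.
case: HV => -[[linTE _] _ [_ TT] TE EE] [TE0 K0] _.
case: (HW) => linV linW trunc _ _.
have T0 m n : 0 <= n -> tT m n one = 0 by move/(TE0 m n) => [].
have E0 m n : 0 <= n -> tE m n one = 0 by move/(TE0 m n) => [].
have linT m n : lin (tT m n) by case: (linTE m n).
have linE m n : lin (tE m n) by case: (linTE m n).
have eqZ (n : int) : (n + -1 + 1 == 0) = (n == 0) by lia.
have eq1 (n : int) : (n + -1 == 0) = (n == 1) by lia.
split; last first.
  move=> m w; have [NT T0w] := trunc (tT m (-1) one) w.
  have [NE E0w] := trunc (tE m (-1) one) w.
  exists (Num.max (- NT) (- NE) + 1) => n le_n _.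
  by rewrite T0w ?E0w //; lia.
have TT0 m r n : 0 <= n -> Y (tT m (-1) one) (tT r (-1) one) n = 0.
  (* Nonnegative modes kill the vacuum, so a product [u_n v] of generators is the bracket of [u_n]
     and [v_{-1}] applied to the vacuum. *)
  move=> le_0n; rewrite HYT; have := TT m n r (-1) one.
  by rewrite (T0 m) // (lin_zero (linT _ _)) subr0.
have TEb m r n : 0 <= n -> Y (tT m (-1) one) (tE r (-1) one) n =
      (n * r + m)%:~R *: Y (tT (m + r) (-1) one) one (n - 2)
    + (m%:~R * dlt C ((m + r == 0) && (n == 0)) * l K1) *: one
    + (n%:~R * dlt C ((m + r == 0) && (n == 1)) * l K2) *: one.
  move=> le_0n; rewrite !HYT; have := TE m n r (-1) one.
  rewrite (T0 m) // (lin_zero (linE _ _)) subr0 => ->.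
  rewrite !K0 !scalerA eqZ eq1 mulrN1 opprK.
  by congr (_ *: tT _ _ _ + _ + _); lia.
have EEb m r n : 0 <= n -> Y (tE m (-1) one) (tE r (-1) one) n =
      (n * r + m)%:~R *: Y (tE (m + r) (-1) one) one (n - 2)
    + (m%:~R * dlt C ((m + r == 0) && (n == 0)) * l K3) *: one
    + (n%:~R * dlt C ((m + r == 0) && (n == 1)) * l K4) *: one.
  move=> le_0n; rewrite !HYE; have := EE m n r (-1) one.
  rewrite (E0 m) // (lin_zero (linE _ _)) subr0 => ->.
  rewrite !K0 !scalerA eqZ eq1 mulrN1 opprK.
  by congr (_ *: tE _ _ _ + _ + _); lia.
have ET0 m r n : 2 <= n -> Y (tE r (-1) one) (tT m (-1) one) n = 0.
  (* The bracket has [T] first, so on the vacuum it gives minus the wanted product; its mode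
     [n - 2 >= 0] kills the vacuum. *)
  move=> le_2n; rewrite HYE; have := TE m (-1) r n one.
  rewrite (E0 r) ?(lin_zero (linT _ _)) ?sub0r; last by lia.
  move/eqP; rewrite eqr_oppLR => /eqP->.
  rewrite T0; last by lia.
  have -> : (-1 + n + 1 == 0) = false by lia.
  have -> : (-1 + n == 0) = false by lia.
  by rewrite andbF /dlt /= !mulr0 !scale0r scaler0 !addr0 oppr0.
have EE0 m r n : 2 <= n -> Y (tE m (-1) one) (tE r (-1) one) n = 0.
  move=> le_2n; rewrite EEb ?HYE ?E0; try lia.
  have -> : (n == 0) = false by lia.
  have -> : (n == 1) = false by lia.
  by rewrite andbF /dlt /= !mulr0 !mul0r !scale0r scaler0 !addr0.
split.
- by split=> [m n _|i a x y]; [split; apply: linW | rewrite scalerDr !scalerA mulrC].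
- by move=> i m n x _; split; rewrite (lin_scale (linW _ _)).
- split=> [i j x|m n r s x _ _]; first by rewrite !scalerA mulrC.
  have TT2 m' r' j : 2 <= j -> Y (tT m' (-1) one) (tT r' (-1) one) j = 0.
    by move=> le_2j; apply: TT0; lia.
  rewrite (module_commutator HVA HW (@TT2 _ _) (@TT2 _ _)) !TT0 //.
  by rewrite !(lin_zero (linV _ _)) scaler0 subr0.
- move=> m n r s x _ _.
  exact: (generator_commutator HVA HW (@TEb m r) (@ET0 m r)).
- move=> m n r s x _ _.
  exact: (generator_commutator HVA HW (@EEb m r) (@EE0 r m)).
Qed.
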